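(* The word problem of the Farey AF algebra $\mathfrak M_1$ is solvable in polynomial time: there exist a polynomial $T:\{0,1,2,\dots\}\to\{0,1,2,\dots\}$ and a Turing machine which, given as input any pair of formulas $(\phi,\psi)$, decides whether $\phi$ and $\psi$ code the same Murray–von Neumann equivalence class of projections of $\mathfrak M_1$ in fewer than $T(\|\phi\|+\|\psi\|)$ steps.
   Context: $\mathcal M_1$ is the MV-algebra of McNaughton functions: continuous piecewise linear $f:[0,1]\to[0,1]$ whose finitely many linear pieces have integer coefficients, with $0$ the zero function, $f^*=1-f$, $f\oplus g=\min(1,f+g)$; it is freely generated by the identity function $\mathrm{id}_{[0,1]}$. The Farey AF algebra $\mathfrak M_1$ is the unital AF algebra whose unital ordered $K_0$-group is isomorphic to the unital $\ell$-group of continuous piecewise linear functions $[0,1]\to\mathbb R$ with integer-coefficient pieces (unit the constant $1$); its Elliott involutive monoid $E(\mathfrak M_1)$ (Murray–von Neumann classes $[p]$ of projections, with the unique total extension $\oplus$ of Elliott's partial addition and involution $[p]^*=[1-p]$) is isomorphic to $\mathcal M_1$. Fix a projection $\mathsf p$ with $[\mathsf p]$ generating $E(\mathfrak M_1)$ and let $\omega:\mathcal M_1\to E(\mathfrak M_1)$ be the isomorphism with $\omega(\mathrm{id}_{[0,1]})=[\mathsf p]$. Formulas are strings over the alphabet $\{0,X,{}^*,\oplus,(,)\}$ defined inductively: $0$ and $X$ are formulas, and if $\phi,\psi$ are formulas then so are $\phi^*$ and $(\phi\oplus\psi)$. Each formula $\phi$ codes a McNaughton function $\mathsf f_\phi$: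 $\mathsf f_0=0$, $\mathsf f_X=\mathrm{id}_{[0,1]}$, $\mathsf f_{\psi^*}=1-\mathsf f_\psi$, $\mathsf f_{(\psi\oplus\chi)}=\min(1,\mathsf f_\psi+\mathsf f_\chi)$; and $\phi$ codes the equivalence class $\omega(\mathsf f_\phi)$ of projections of $\mathfrak M_1$. $\|\phi\|$ is the number of symbol occurrences in $\phi$. The word problem of $\mathfrak M_1$ asks, given formulas $\phi,\psi$, whether $\omega(\mathsf f_\phi)=\omega(\mathsf f_\psi)$. *)

(* Defs.v *)
From HB Require Import structures.
From mathcomp Require Import all_boot all_order all_algebra.
From mathcomp Require Import complex.
From mathcomp Require Import boolp classical_sets functions reals topology normedtype.

Set Implicit Arguments.
Unset Strict Implicit.
Unset Printing Implicit Defensive.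

Import Order.TTheory GRing.Theory Num.Theory numFieldNormedType.Exports.

Local Open Scope classical_set_scope.
Local Open Scope ring_scope.

(* The norm is a field [cnorm : A -> R] of the structure: the normed modules of
   the analysis library over [R[i]] cannot be joined with [algType R[i]]. *)
HB.mixin Record isCStar (R : realType) A of GRing.Algebra R[i] A := {
  star : A -> A;
  cnorm : A -> R;
  starK : involutive star;
  starD : {morph star : x y / x + y};
  starZ : forall (c : R[i]) (x : A), star (c *: x) = (c^*)%C *: star x;
  starM : forall x y : A, star (x * y) = star y * star x;
  cnorm_eq0 : forall x : A, cnorm x = 0 -> x = 0;
  cnormD : forall x y : A, cnorm (x + y) <= cnorm x + cnorm y;
  cnormZ : forall (c : R[i]) (x : A), cnorm (c *: x) = Normc.normc c * cnorm x;
  cnormM : forall x y : A, cnorm (x * y) <= cnorm x * cnorm y;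
  cnorm_star : forall x : A, cnorm (star x * x) = cnorm x ^+ 2;
  cnorm_complete : forall u : nat -> A,
    (forall e : R, 0 < e -> exists N : nat,
       forall m n : nat, (N <= m)%N -> (N <= n)%N -> cnorm (u m - u n) < e) ->
    exists l : A, (fun n => cnorm (u n - l)) @ \oo --> (0 : R)
}.

#[short(type="cstarAlgType")]
HB.structure Definition CStarAlgebra (R : realType) :=
  {A of GRing.Algebra R[i] A & isCStar R A}.

Section CStarTheory.
Context {R : realType} {A : cstarAlgType R}.
Implicit Types x y : A.

Lemma star0 : star (0 : A) = 0.
Proof. by apply: (addrI (star (0 : A))); rewrite -starD !addr0. Qed.

Lemma starN x : star (- x) = - star x.
Proof. by apply: (addrI (star x)); rewrite -starD !subrr star0. Qed.

Lemma star1 : star (1 : A) = 1.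
Proof. by rewrite -[RHS](starK 1) -[star 1 in RHS]mulr1 starM starK mulr1. Qed.

Definition fin_dim (S : set A) :=
  exists (k : nat) (b : 'I_k -> A),
    forall x, S x -> exists c : 'I_k -> R[i], x = \sum_(i < k) c i *: b i.

Definition fin_dim_star_subalgebra (S : set A) :=
  [/\ GRing.subalg_closed (mem S), (forall x, S x -> S (star x)) & fin_dim S].

End CStarTheory.

(* [GRing.subalg_closed] includes 1: all the [F n] have the unit of [A]. *)
Definition is_AF (R : realType) (A : cstarAlgType R) :=
  exists F : nat -> set A,
    [/\ forall n, fin_dim_star_subalgebra (F n),
        forall n, F n `<=` F n.+1
      & forall (x : A) (e : R), 0 < e ->
          exists n, exists2 y, F n y & cnorm (x - y) < e].

Section Projections.
Context {R : realType}.

Record projection (A : cstarAlgType R) := Projection {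
  proj_val :> A;
  proj_idem : proj_val * proj_val = proj_val;
  proj_star : star proj_val = proj_val
}.

Context {A : cstarAlgType R}.

Program Definition proj0 : projection A := @Projection A 0 _ _.
Next Obligation. by rewrite mul0r. Qed.
Next Obligation. exact: star0. Qed.

Program Definition proj1 : projection A := @Projection A 1 _ _.
Next Obligation. by rewrite mul1r. Qed.
Next Obligation. exact: star1. Qed.

Program Definition projC (p : projection A) : projection A :=
  @Projection A (1 - (p : A)) _ _.
Next Obligation.
by move=> p; rewrite mulrBl mul1r mulrBr mulr1 proj_idem subrr subr0.
Qed.
Next Obligation. by move=> p; rewrite starD starN star1 proj_star. Qed.

Definition murray_von_neumann (p q : projection A) :=
  exists v : A, star v * v = (p : A) /\ v * star v = (q : A).

End Projections.

Definition mvn_classes (R : realType) (A : cstarAlgType R) :=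
  {X : set (projection A) | exists p, X = [set q | murray_von_neumann p q]}.

Section Elliott.
Context {R : realType} {A : cstarAlgType R}.

Definition mvn_class (p : projection A) : mvn_classes A :=
  exist _ [set q | murray_von_neumann p q] (ex_intro _ p erefl).

(* As p and q range over the representatives of the two classes, this says that
   any representative of X is equivalent to a subprojection of one of Y. *)
Definition mvn_le (X Y : mvn_classes A) :=
  exists p q : projection A,
    [/\ X = mvn_class p, Y = mvn_class q & (p : A) * (q : A) = (p : A)].

End Elliott.

(* Elliott's partial addition is [p] + [q] = [p + q] for orthogonal p and q.
   By a theorem of Mundici and Panti, in an AF-algebra it has at most one total
   extension that is associative, commutative, monotone, and such that
   [1 - p] is the smallest [q] with [p] (+) [q] = [1]. *)
Record elliott_monoid (R : realType) (A : cstarAlgType R) := ElliottMonoid {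
  eplus : mvn_classes A -> mvn_classes A -> mvn_classes A;
  estar : mvn_classes A -> mvn_classes A;
  eplus_partial : forall p q r : projection A,
    (p : A) * (q : A) = 0 -> (r : A) = (p : A) + (q : A) ->
    eplus (mvn_class p) (mvn_class q) = mvn_class r;
  estarE : forall p : projection A,
    estar (mvn_class p) = mvn_class (projC p);
  eplusA : associative eplus;
  eplusC : commutative eplus;
  eplus_mono : forall X X' Y Y', mvn_le X X' -> mvn_le Y Y' ->
    mvn_le (eplus X Y) (eplus X' Y');
  eplus_star : forall X, eplus X (estar X) = mvn_class proj1;
  eplus_residuation : forall X Y,
    eplus X Y = mvn_class proj1 -> mvn_le (estar X) Y
}.

Definition generates (R : realType) (A : cstarAlgType R)
    (E : elliott_monoid A) (X : mvn_classes A) :=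
  forall S : set (mvn_classes A),
    S X -> S (mvn_class proj0) ->
    (forall Y, S Y -> S (estar E Y)) ->
    (forall Y Z, S Y -> S Z -> S (eplus E Y Z)) ->
    forall Y, S Y.

Section K0.
Context {R : realType}.

Definition adjmx {A : cstarAlgType R} m n (M : 'M[A]_(m, n)) : 'M[A]_(n, m) :=
  (map_mx star M)^T.

Record mxproj (A : cstarAlgType R) := MxProj {
  mxproj_size : nat;
  mxproj_val :> 'M[A]_mxproj_size;
  mxproj_idem : mxproj_val *m mxproj_val = mxproj_val;
  mxproj_adj : adjmx mxproj_val = mxproj_val
}.

Context {A : cstarAlgType R}.
Implicit Types P Q : mxproj A.

(* Projections of different sizes are compared in the union of the matrix
   algebras over [A], whence the rectangular [V]. *)
Definition mx_mvn P Q :=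
  exists V : 'M[A]_(mxproj_size Q, mxproj_size P),
    adjmx V *m V = P /\ V *m adjmx V = Q.

Program Definition mxproj_sum P Q : mxproj A :=
  @MxProj A _ (block_mx P 0 0 Q) _ _.
Next Obligation.
move=> P Q; rewrite mulmx_block !mulmx0 !mul0mx !addr0 !add0r.
by rewrite !mxproj_idem.
Qed.
Next Obligation.
move=> P Q.
have adj0 m n : adjmx (0 : 'M[A]_(m, n)) = 0.
  by apply/matrixP => i j; rewrite !mxE star0.
move: (adj0 (mxproj_size P) (mxproj_size Q)) (adj0 (mxproj_size Q) (mxproj_size P)).
rewrite /adjmx map_block_mx tr_block_mx => -> ->.
by rewrite -2![(map_mx _ _)^T]/(adjmx _) !mxproj_adj.
Qed.

Program Definition mxproj0 : mxproj A := @MxProj A 0 0 _ _.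
Next Obligation. by rewrite mul0mx. Qed.
Next Obligation. by apply/matrixP => -[]. Qed.

Program Definition mxproj1 : mxproj A := @MxProj A 1 1%:M _ _.
Next Obligation. by rewrite mul1mx. Qed.
Next Obligation. by apply/matrixP => i j; rewrite !ord1 !mxE star1. Qed.

(* A pair (P, Q) stands for the formal difference [P] - [Q]: K_0 of [A] is the
   quotient of [mxproj A * mxproj A] by [K0_eq]. *)
Definition K0_eq (x y : mxproj A * mxproj A) :=
  exists S : mxproj A,
    mx_mvn (mxproj_sum (mxproj_sum x.1 y.2) S)
           (mxproj_sum (mxproj_sum y.1 x.2) S).

Definition K0_add (x y : mxproj A * mxproj A) :=
  (mxproj_sum x.1 y.1, mxproj_sum x.2 y.2).

End K0.

(* [G] is a subgroup of an ambient group [V], [Gpos] its positive cone and [u]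
   its unit. The map [kappa] is an isomorphism from K_0 of [A], given on formal
   differences. *)
Definition K0_isomorphic (R : realType) (A : cstarAlgType R) (V : zmodType)
    (G Gpos : set V) (u : V) :=
  exists kappa : mxproj A * mxproj A -> V,
    [/\ forall x y, kappa x = kappa y <-> K0_eq x y,
        range kappa = G,
        {morph kappa : x y / K0_add x y >-> x + y},
        [set kappa (P, mxproj0) | P in [set: mxproj A]] = Gpos
      & kappa (mxproj1, mxproj0) = u].

Definition unit_interval (R : realType) := set_type `[0 : R, 1 : R].

(* Continuous, and at each point equal to one of finitely many affine functions
   with integer coefficients *)
Definition pl_int (R : realType) (f : unit_interval R -> R) :=
  continuous f /\
  exists s : seq (int * int), forall x : unit_interval R,
    exists2 ab, ab \in s & f x = ab.1%:~R * \val x + ab.2%:~R.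

Record mcnaughton (R : realType) := McNaughton {
  mc_val :> unit_interval R -> R;
  mc_pl : pl_int mc_val;
  mc_bound : forall x, 0 <= mc_val x <= 1
}.

Section McNaughtonOps.
Context {R : realType}.
Implicit Types f g : mcnaughton R.

Program Definition mc0 : mcnaughton R := @McNaughton R (fun=> 0) _ _.
Next Obligation.
split; first exact: cst_continuous.
by exists [:: (0, 0)] => x; exists (0, 0); rewrite ?mem_head //= mul0r addr0.
Qed.
Next Obligation. by move=> x; rewrite lexx ler01. Qed.

Program Definition mc_id : mcnaughton R := @McNaughton R (fun x => \val x) _ _.
Next Obligation.
split; first exact: initial_continuous.
by exists [:: (1, 0)] => x; exists (1, 0); rewrite ?mem_head //= mul1r addr0.
Qed.
Next Obligation. by move=> x; have := set_valP x; rewrite /= in_itv. Qed.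

Program Definition mc_star f : mcnaughton R :=
  @McNaughton R (fun x => 1 - f x) _ _.
Next Obligation.
move=> f; case: (mc_pl f) => cf [s fs]; split.
  by move=> x; apply: continuousB; [exact: cst_continuous | exact: cf].
exists [seq (- ab.1, 1 - ab.2) | ab <- s] => x.
have [ab abs ->] := fs x; exists (- ab.1, 1 - ab.2).
  by apply/mapP; exists ab.
by rewrite /= intrB mulrNz mulNr opprD addrCA.
Qed.
Next Obligation.
by move=> f x; have /andP[f0 f1] := mc_bound f x; rewrite subr_ge0 f1 gerBl.
Qed.

Program Definition mc_oplus f g : mcnaughton R :=
  @McNaughton R (fun x => Num.min 1 (f x + g x)) _ _.
Next Obligation.
move=> f g; case: (mc_pl f) (mc_pl g) => cf [s fs] [cg [t gt]]; split.
  move=> x; apply: (@continuous_min _ _ (fun=> 1) (fun y => f y + g y)).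
    exact: cst_continuous.
  by apply: continuousD; [exact: cf | exact: cg].
exists ((0, 1) :: [seq (a.1 + b.1, a.2 + b.2) | a <- s, b <- t]) => x.
have [a sa ->] := fs x; have [b tb ->] := gt x; rewrite /Num.min.
case: ifP => _; first by exists (0, 1); rewrite ?mem_head //= mul0r add0r.
exists (a.1 + b.1, a.2 + b.2) => /=.
  by rewrite in_cons; apply/orP; right; apply/allpairsP; exists (a, b).
by rewrite !intrD mulrDl addrACA.
Qed.
Next Obligation.
move=> f g x; have /andP[f0 _] := mc_bound f x; have /andP[g0 _] := mc_bound g x.
by rewrite ge_min lexx le_min ler01 addr_ge0.
Qed.

End McNaughtonOps.

Definition is_farey_AF (R : realType) (A : cstarAlgType R) :=
  is_AF A /\
  @K0_isomorphic R A (unit_interval R -> R)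
    [set f | pl_int f]
    [set f | pl_int f /\ forall x, 0 <= f x]
    (fun=> 1).

Record is_elliott_iso (R : realType) (A : cstarAlgType R)
    (E : elliott_monoid A) (omega : mcnaughton R -> mvn_classes A) : Prop := {
  elliott_iso_bij : bijective omega;
  elliott_iso0 : omega mc0 = mvn_class proj0;
  elliott_isoS : forall f, omega (mc_star f) = estar E (omega f);
  elliott_isoD : forall f g,
    omega (mc_oplus f g) = eplus E (omega f) (omega g)
}.

Inductive symbol := SZero | SX | SStar | SOplus | SLpar | SRpar.

Inductive formula :=
  | FZero
  | FVar
  | FStar of formula
  | FOplus of formula & formula.

Fixpoint formula_string (phi : formula) : seq symbol :=
  match phi with
  | FZero => [:: SZero]
  | FVar => [:: SX]
  | FStar psi => rcons (formula_string psi) SStar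
  | FOplus psi chi =>
      SLpar :: formula_string psi ++ SOplus :: formula_string chi ++ [:: SRpar]
  end.

Definition formula_length (phi : formula) : nat := size (formula_string phi).

Fixpoint formula_fun (R : realType) (phi : formula) : mcnaughton R :=
  match phi with
  | FZero => mc0
  | FVar => mc_id
  | FStar psi => mc_star (formula_fun R psi)
  | FOplus psi chi => mc_oplus (formula_fun R psi) (formula_fun R chi)
  end.

(* Machines are deterministic with one tape, infinite in both directions. A cell is
   blank ([None]) or holds an input letter or one of finitely many auxiliary
   letters. A state with [tm_answer q = Some b] is halting, with answer [b]. *)
Inductive direction := GoLeft | Stay | GoRight.

Record turing_machine (I : Type) := TuringMachine {
  tm_state : finType;
  tm_aux : finType;
  tm_start : tm_state;
  tm_answer : tm_state -> option bool;
  tm_trans : tm_state -> option (I + tm_aux) ->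
             tm_state * option (I + tm_aux) * direction
}.

Section Run.
Context {I : Type} (M : turing_machine I).

Let cell : Type := option (I + tm_aux M).

(* The head is on the first cell of [right], or on a blank if it is empty;
   [left] is read from the head outwards. All other cells are blank. *)
Record config := Config {
  conf_state : tm_state M;
  conf_left : seq cell;
  conf_right : seq cell
}.

Definition tm_step (c : config) : config :=
  let: Config q l r := c in
  if tm_answer q is Some _ then c else
  let: (q', a, d) := tm_trans q (head None r) in
  let r' := a :: behead r in
  match d with
  | GoLeft => Config q' (behead l) (head None l :: r')
  | Stay => Config q' l r'
  | GoRight => Config q' (a :: l) (behead r)
  end.

Definition tm_init (w : seq I) : config :=
  Config (tm_start M) [::] [seq Some (inl i) | i <- w].

Definition tm_halts_with (w : seq I) (t : nat) (b : bool) :=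
  tm_answer (conf_state (iter t tm_step (tm_init w))) = Some b.

End Run.

(* The pair (phi, psi) is written phi, separator, psi; [None] is the
   separator. *)
Definition pair_string (phi psi : formula) : seq (option symbol) :=
  [seq Some s | s <- formula_string phi] ++
  None :: [seq Some s | s <- formula_string psi].

(* Main.v *)
(* Since omega is injective, two formulas have to be compared as functions. On an
   interval whose interior contains no rational of denominator at most K, a formula
   with at most K occurrences of X is affine. Distinct such rationals are at distance at
   least 1 / K ^ 2, so, if 2 K ^ 2 <= d, every point of [0, 1] lies in such an
   interval that contains two consecutive points i / d. Hence two formulas code the
   same function as soon as they agree at the points i / d, where their values are
   computed in the finite chain {0, 1 / d, ..., 1}, with numbers in unary: a formula
   without its left parentheses and its plus signs is in reverse Polish notation.
   A machine with eight stacks does this in polynomially many steps, and a Turing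
   machine keeps these stacks on tracks of its tape, the tops in the first cell, so
   that each step is one sweep over the tape and back. *)

From HB Require Import structures.
Require Import Defs.
From mathcomp Require Import all_boot all_order all_algebra.
From mathcomp Require Import boolp classical_sets reals.
From mathcomp Require Import zify ring lra.

Set Implicit Arguments.
Unset Strict Implicit.
Unset Printing Implicit Defensive.

Import Order.TTheory GRing.Theory Num.Theory.

(** * Formulas as functions *)

Section Functions.
Local Open Scope ring_scope.

Fixpoint formula_eval (R : realDomainType) (x : R) (phi : formula) : R :=
  match phi with
  | FZero => 0
  | FVar => x
  | FStar psi => 1 - formula_eval x psi
  | FOplus psi chi => Num.min 1 (formula_eval x psi + formula_eval x chi)
  end.

Lemma formula_funE (R : realType) phi (x : unit_interval R) :
  formula_fun R phi x = formula_eval (\val x) phi.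
Proof. by elim: phi => //= [psi -> //|psi -> chi ->]. Qed.

Lemma formula_fun_eqP (R : realType) phi psi :
  formula_fun R phi = formula_fun R psi <->
  forall x : R, 0 <= x <= 1 -> formula_eval x phi = formula_eval x psi.
Proof.
split=> [eq_f x x01|eq_e].
  have xI : x \in (`[0 : R, 1]%classic : set R) by rewrite inE /= in_itv.
  by have := congr1 (fun f : mcnaughton R => f (SigSub xI)) eq_f;
    rewrite !formula_funE.
have: mc_val (formula_fun R phi) = mc_val (formula_fun R psi).
  apply/funext => x; rewrite !formula_funE; apply: eq_e.
  by have := set_valP x; rewrite /= in_itv.
case: (formula_fun R phi) (formula_fun R psi) => f f1 f2 [g g1 g2] /= fg.
by subst g; congr McNaughton; exact: Prop_irrelevance.
Qed.

Fixpoint formula_vars (phi : formula) : nat :=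
  match phi with
  | FZero => 0
  | FVar => 1
  | FStar psi => formula_vars psi
  | FOplus psi chi => formula_vars psi + formula_vars chi
  end.

(** Each sum brings three symbols of its own. The factor 2 lets the bound [K] on the occurrences of
    X be half the length, so that a triangular number of grid steps suffices. *)
Lemma formula_vars_length phi :
  ((formula_vars phi).*2 <= (formula_length phi).+1)%N.
Proof.
rewrite /formula_length; elim: phi => //= [psi|psi IHpsi chi IHchi].
  by rewrite size_rcons; lia.
by rewrite !(size_cat, size_rcons) /= size_cat /=; lia.
Qed.

(* The value at [i / d], in units of [1 / d]. *)
Fixpoint chain_eval (d i : nat) (phi : formula) : nat :=
  match phi with
  | FZero => 0
  | FVar => i
  | FStar psi => d - chain_eval d i psi
  | FOplus psi chi => minn d (chain_eval d i psi + chain_eval d i chi)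
  end.

Lemma chain_eval_le d i phi : (i <= d)%N -> (chain_eval d i phi <= d)%N.
Proof. by move=> id; elim: phi => //= *; lia. Qed.

Lemma formula_eval_chain (R : realFieldType) d i phi : (0 < d)%N -> (i <= d)%N ->
  formula_eval (i%:R / d%:R : R) phi = (chain_eval d i phi)%:R / d%:R.
Proof.
move=> d0 id; have dR : (d%:R : R) != 0 by rewrite pnatr_eq0 -lt0n.
elim: phi => [||psi IH|psi IHpsi chi IHchi] /=; rewrite ?mul0r //.
  by rewrite IH natrB ?chain_eval_le // mulrBl divff.
rewrite IHpsi IHchi -mulrDl -natrD.
case: (leqP d (chain_eval d i psi + chain_eval d i chi)) => h.
  by rewrite divff // min_l // ler_pdivlMr ?ltr0n // mul1r ler_nat.
by rewrite min_r // ler_pdivrMr ?ltr0n // mul1r ler_nat ltnW.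
Qed.

(** * Breakpoints of formulas as fractions of bounded denominator *)

Section Farey.
Variables (R : realFieldType) (K : nat).

(** The fractions may be unreduced and lie anywhere on the line, so that they include every solution
    of [a * x + b = 1] with integers [a], [b] and [0 < |a| <= K]. *)
Definition farey (c : R) :=
  exists (p : int) (q : nat), (0 < q <= K)%N /\ c = p%:~R / q%:R.

(** The difference is an integer over [q * q']; being positive, this integer is at least 1. *)
Lemma farey_gap (c c' : R) : farey c -> farey c' -> c < c' ->
  c + (K * K)%:R^-1 <= c'.
Proof.
move=> [p [q [/andP[q0 qK] ->]]] [p' [q' [/andP[q'0 q'K] ->]]] ltcc'.
have qR : (0 : R) < q%:R by rewrite ltr0n.
have q'R : (0 : R) < q'%:R by rewrite ltr0n.
have le1 : 1 <= (p' * q%:Z - p * q'%:Z)%:~R :> R.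
  rewrite ler1z -gtz0_ge1 subr_gt0 -(ltr_int R) !rmorphM /=.
  by move: ltcc'; rewrite ltr_pdivrMr // mulrAC ltr_pdivlMr.
have -> : p'%:~R / q'%:R = p%:~R / q%:R
    + (p' * q%:Z - p * q'%:Z)%:~R * (q * q')%:R^-1 :> R.
  rewrite rmorphB !rmorphM /= -!pmulrn; field.
  by rewrite !lt0r_neq0.
rewrite lerD2l (le_trans _ (ler_pM _ _ le1 (lexx _))) ?mul1r ?invr_ge0 ?ler0n //.
by rewrite lef_pV2 ?posrE ?ltr0n ?muln_gt0 ?q0 // ?ler_nat ?leq_mul //; lia.
Qed.

(** A new breakpoint can arise only where a sum [A * x + B] crosses 1. Slopes add up and truncation
    replaces them by 0, so [|A|] is at most the number of occurrences of X; the crossing is then a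
    Farey point and is not interior to the interval. *)
Lemma formula_eval_affine (l r : R) phi : l <= r ->
    (forall c, farey c -> ~~ (l < c < r)) -> (formula_vars phi <= K)%N ->
  exists a b : int, (`|a| <= formula_vars phi)%N /\
    forall x, l <= x <= r -> formula_eval x phi = a%:~R * x + b%:~R.
Proof.
move=> lr noc; elim: phi => [||psi IH|psi IH1 chi IH2] /= hK.
- by exists 0, 0; split=> // x _; rewrite mul0r addr0.
- by exists 1, 0; split=> // x _; rewrite mul1r addr0.
- have [a [b [ha hx]]] := IH hK; exists (- a), (1 - b); split; first by lia.
  by move=> x /hx ->; rewrite rmorphN rmorphB /=; ring.
have [|a1 [b1 [ha1 hx1]]] := IH1; first by lia.
have [|a2 [b2 [ha2 hx2]]] := IH2; first by lia.
set A := a1 + a2; set B := b1 + b2.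
have hA : (`|A| <= formula_vars psi + formula_vars chi)%N by rewrite /A; lia.
have hsum x : l <= x <= r ->
    formula_eval x psi + formula_eval x chi = A%:~R * x + B%:~R.
  by move=> lxr; rewrite hx1 // hx2 // !rmorphD /=; ring.
have [above|below] :
    (forall x, l <= x <= r -> 1 <= A%:~R * x + B%:~R) \/
    (forall x, l <= x <= r -> A%:~R * x + B%:~R <= 1).
  have [A0|A0] := eqVneq A 0.
    by case: (leP 1 (B%:~R : R)) => h; [left|right] => x _;
      rewrite A0 mul0r add0r // ltW.
  have AR : (A%:~R : R) != 0 by rewrite intr_eq0.
  set rho := (1 - B%:~R) / A%:~R : R.
  have lineE x : A%:~R * x + B%:~R = 1 + A%:~R * (x - rho).
    by rewrite /rho; field.
  have /noc : farey rho.
    (* The sign of [A] goes to the numerator, so that the denominator is positive. *)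
    exists ((1 - B) * sgz A), `|A|%N; split; first by lia.
    have -> : (`|A|%N)%:R = (A * sgz A)%:~R :> R.
      by rewrite mulrC -normrEsg -abszE.
    have sR : ((sgz A)%:~R : R) != 0 by rewrite intr_eq0 sgz_eq0.
    by rewrite /rho !rmorphM rmorphB /=; field; rewrite AR sR.
  rewrite negb_and -!leNgt => /orP rho_out.
  have [A_lt0|A_gt0] : (A%:~R : R) < 0 \/ (0 : R) < A%:~R.
    by case: ltgtP AR => //; [left|right].
  - by case: rho_out => h; [right|left] => x /andP[lx xr]; rewrite lineE; nra.
  - by case: rho_out => h; [left|right] => x /andP[lx xr]; rewrite lineE; nra.
- by exists 0, 1; split=> // x lxr; rewrite hsum // min_l ?above // mul0r add0r.
- by exists A, B; split=> // x lxr; rewrite hsum // min_r // below.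
Qed.

End Farey.

(** Take the grid cell that contains [x]. If no Farey point is inside, both formulas are affine on
    it. Otherwise a Farey point [c] is inside, and on the side of [x] both are affine from [c] to
    the far end of the neighbouring cell. *)
Lemma formula_eval_eq_chain (R : realType) (K d : nat) phi psi :
    (0 < K)%N -> (2 * (K * K) <= d)%N ->
    (formula_vars phi <= K)%N -> (formula_vars psi <= K)%N ->
    (forall i, (i <= d)%N -> chain_eval d i phi = chain_eval d i psi) ->
  forall x : R, 0 <= x <= 1 -> formula_eval x phi = formula_eval x psi.
Proof.
move=> K0 dK hphi hpsi eq_chain x /andP[x0 x1].
have d0 : (0 < d)%N by lia.
have dR : (0 : R) < d%:R by rewrite ltr0n.
pose e := d%:R^-1 : R; have e0 : 0 < e by rewrite invr_gt0.
have eq_grid i : (i <= d)%N ->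
    formula_eval (i%:R * e) phi = formula_eval (i%:R * e) psi.
  by move=> id; rewrite !formula_eval_chain // eq_chain.
(* By the choice of [d], the Farey gap is at least two grid steps. *)
have gap (c c' : R) : farey K c -> farey K c' -> c < c' -> c + 2 * e <= c'.
  move=> hc hc' lt_cc'; apply: le_trans (farey_gap hc hc' lt_cc').
  rewrite lerD2l -[2]/(2%:R) ler_pdivrMr // ler_pdivlMl ?ltr0n ?muln_gt0 ?K0 //.
  by rewrite -natrM ler_nat mulnC.
have eq_on (l r : R) i : (forall c, farey K c -> ~~ (l < c < r)) ->
    (i < d)%N -> l <= i%:R * e -> i%:R * e + e <= r -> l <= x <= r ->
    formula_eval x phi = formula_eval x psi.
  move=> noc id li ir lxr.
  have lr : l <= r by lra.
  have [a [b [_ fE]]] := formula_eval_affine lr noc hphi.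
  have [a' [b' [_ gE]]] := formula_eval_affine lr noc hpsi.
  have := eq_grid i (ltnW id); have := eq_grid i.+1 id.
  rewrite -natr1 mulrDl mul1r !fE ?gE; try lra.
  set y := i%:R * e => e2 e1.
  have eqa : (a%:~R : R) = a'%:~R.
    have : (a%:~R - a'%:~R) * e = 0 by lra.
    by move/eqP; rewrite mulf_eq0 (gt_eqF e0) orbF subr_eq0 => /eqP.
  by move: e1; rewrite eqa => /addrI ->.
have f0 : farey K (0 : R) by exists 0, 1%N; rewrite mul0r; split=> //; lia.
have f1 : farey K (1 : R) by exists 1, 1%N; rewrite divr1; split=> //; lia.
pose i := Num.truncn (x * d%:R).
have /andP[ix xi] : i%:R <= x * d%:R < i.+1%:R.
  by apply: truncn_itv; rewrite mulr_ge0 // ltW.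
have {}ix : i%:R * e <= x by rewrite ler_pdivrMr.
have {}xi : x < i%:R * e + e.
  by rewrite -{2}[e]mul1r -mulrDl natr1 ltr_pdivlMr.
have [id|di] := ltnP i d; last first.
  (* Here [x = 1], itself a grid point. *)
  have : 1 <= i%:R * e by rewrite ler_pdivlMr // mul1r ler_nat.
  by move=> ?; have -> : x = d%:R * e; [rewrite divff ?gt_eqF //; lra|exact: eq_grid].
have de : d%:R * e = 1 by rewrite divff ?gt_eqF.
have [[c [hc /andP[ic ci]]]|noc] :=
  pselect (exists c, farey K c /\ i%:R * e < c < i%:R * e + e); last first.
  apply: (eq_on (i%:R * e) (i%:R * e + e) i) => //; last by rewrite ix ltW.
  by move=> c hc; apply/negP => ?; apply: noc; exists c.
have [xc|cx] := leP x c.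
  (* The cell on the left serves. It exists: in the first cell, [c] would be too close to the Farey
     point 0. *)
  have [i0|i_gt0] := posnP i.
    have : 0 < c by move: ic; rewrite i0 mul0r.
    by move/(gap _ _ f0 hc); move: ci; rewrite i0 mul0r; lra.
  have iE : i.-1%:R * e = i%:R * e - e.
    by rewrite -[in RHS](prednK i_gt0) -natr1 mulrDl mul1r addrK.
  apply: (eq_on (i%:R * e - e) c i.-1); rewrite ?iE //; try lra; last by lia.
  by move=> c' hc'; apply/negP => /andP[h1 h2]; have := gap _ _ hc' hc h2; lra.
(* Symmetrically, in the last cell [c] would be too close to the Farey point 1. *)
have [i1|i1] := leqP d i.+1.
  have i1E : i%:R * e + e = 1.
    rewrite -[e in _ + e]mul1r -mulrDl natr1.
    by have -> : i.+1 = d by lia.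
  by have := gap _ _ hc f1; lra.
have iE : i.+1%:R * e = i%:R * e + e by rewrite -natr1 mulrDl mul1r.
apply: (eq_on c (i%:R * e + e + e) i.+1); rewrite ?iE //; try lra.
by move=> c' hc'; apply/negP => /andP[h1 h2]; have := gap _ _ hc hc' h1; lra.
Qed.


Lemma formula_fun_chainP (R : realType) (K d : nat) phi psi :
    (0 < K)%N -> (2 * (K * K) <= d)%N ->
    (formula_vars phi <= K)%N -> (formula_vars psi <= K)%N ->
  formula_fun R phi = formula_fun R psi <->
  forall i, (i <= d)%N -> chain_eval d i phi = chain_eval d i psi.
Proof.
move=> K0 dK hphi hpsi; have d0 : (0 < d)%N by lia.
have dR : (0 : R) < d%:R by rewrite ltr0n.
rewrite formula_fun_eqP; split=> [eq_e i id|eq_c]; last first.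
  exact: (formula_eval_eq_chain K0 dK).
have := eq_e (i%:R / d%:R); rewrite divr_ge0 ?ler0n //= ler_pdivrMr // mul1r.
rewrite ler_nat id !formula_eval_chain // => /(_ isT).
by move/(divIf (lt0r_neq0 dR))/eqP; rewrite eqr_nat => /eqP.
Qed.

End Functions.

(** * Stack machines on a single tape *)

(* An operation on a stack: [None] keeps it, [Some None] pops it, and
   [Some (Some a)] pushes [a]. *)
Notation stack_op S := (option (option S)).

Record stack_machine (S : finType) := StackMachine {
  sm_state : finType;
  sm_stack : finType;
  sm_start : sm_state;
  sm_answer : sm_state -> option bool;
  sm_trans : sm_state -> (sm_stack -> option S) ->
             sm_state * (sm_stack -> stack_op S)
}.

Definition stack_act S (o : stack_op S) (s : seq S) : seq S :=
  match o with
  | None => s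
  | Some None => behead s
  | Some (Some a) => a :: s
  end.

Section StackRun.
Variables (S : finType) (P : stack_machine S).

Definition stack_step (c : sm_state P * (sm_stack P -> seq S)) :=
  let: (q, s) := c in
  if sm_answer q is Some _ then c else
  let: (q', o) := sm_trans q (fun j => ohead (s j)) in
  (q', fun j => stack_act (o j) (s j)).

End StackRun.

Section Tracks.
Variables (I : Type) (S : finType) (P : stack_machine S).
Variables (j0 : sm_stack P) (load : I -> S).

Local Notation J := (sm_stack P).
Local Notation cell := {ffun J -> option S}.
Local Notation ops := {ffun J -> stack_op S}.

Definition blank_cell : cell := [ffun => None].

Definition load_cell (i : I) : cell :=
  [ffun j => if j == j0 then Some (load i) else None].

(** A push shifts its track one cell to the right, so the sweep to the right carries along the old
    content of the cell just left. A pop shifts its track to the left and is done on the way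
    back. *)
Definition push_cell (o : ops) (prev c : cell) : cell :=
  [ffun j => if o j is Some (Some _) then prev j else c j].

Definition pop_cell (o : ops) (next c : cell) : cell :=
  [ffun j => if o j is Some None then next j else c j].

(** The pushed letters, seen as the content of a cell before the first one. *)
Definition pushed (o : ops) : cell := [ffun j => obind id (o j)].

(* The states of the Turing machine: loading the input, being about to simulate
   a step, and sweeping over the tape, to the right if the boolean is true; the
   last component of a sweep is the content of the previous cell. *)
Definition track_state : finType :=
  (unit + sm_state P + bool * sm_state P * ops * cell)%type.

Definition sweep b q o c : track_state := inr (b, q, o, c).

(** Loading ends with a sweep back that performs no operation. Every sweep to the right adds a cell,
    whether or not a letter is pushed, so the tape grows by one cell per simulated step. *)
Definition track_trans (st : track_state) (a : option (I + cell)) :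
    track_state * option (I + cell) * direction :=
  match st with
  | inl (inl _) =>
      if a is Some (inl i) then (st, Some (inr (load_cell i)), GoRight)
      else (sweep false (sm_start P) [ffun => None] blank_cell,
            Some (inr blank_cell), GoLeft)
  | inl (inr q) =>
      let c := if a is Some (inr c) then c else blank_cell in
      let: (q', o) := sm_trans q c in
      let o' := [ffun j => o j] in (sweep true q' o' (pushed o'), a, Stay)
  | inr (true, q, o, prev) =>
      if a is Some (inr c) then
        (sweep true q o c, Some (inr (push_cell o prev c)), GoRight)
      else (sweep false q o blank_cell,
            Some (inr (push_cell o prev blank_cell)), GoLeft)
  | inr (false, q, o, next) =>
      if a is Some (inr c) then
        (sweep false q o c, Some (inr (pop_cell o next c)), GoLeft)
      else (inl (inr q), None, GoRight)
  end.

Definition track_machine : turing_machine I :=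
  @TuringMachine I track_state cell (inl (inl tt))
    (fun st => if st is inl (inr q) then sm_answer q else None) track_trans.

Local Notation step := (@tm_step I track_machine).
Local Notation conf := (config track_machine).
Local Notation Conf := (@Config I track_machine).
Local Notation sym c := (Some (inr c) : option (I + cell)).
Local Notation syms cs := ([seq sym c | c <- cs]).

Lemma sweep_right q o prev l cs :
  iter (size cs) step (Conf (sweep true q o prev) l (syms cs)) =
  Conf (sweep true q o (last prev cs))
    (rev (syms (pairmap (push_cell o) prev cs)) ++ l) [::].
Proof.
elim: cs prev l => [//|c cs IH] prev l.
by rewrite [size _]/= iterSr /= IH rev_cons cat_rcons.
Qed.

(** [ds] lists the cells from the head leftwards. The [head] and [behead] are what a left move
    leaves, and they still describe the tape once [ds] is exhausted. *)
Lemma sweep_left q o next ds l r :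
  iter (size ds) step
    (Conf (sweep false q o next) (behead (syms ds ++ l))
       (head None (syms ds ++ l) :: r)) =
  Conf (sweep false q o (last next ds)) (behead l)
    (head None l :: rev (syms (pairmap (pop_cell o) next ds)) ++ r).
Proof.
elim: ds next r => [//|d ds IH] next r.
by rewrite [size _]/= iterSr /= IH rev_cons cat_rcons.
Qed.

(** The sweep back meets the cells from right to left, hence the two reversals. *)
Definition pops o (cs : seq cell) := rev (pairmap (pop_cell o) blank_cell (rev cs)).

(** The extra step finds the blank to the left of the tape and turns back. On the first return this
    blank is not yet listed in [l]; afterwards it is. *)
Lemma sweep_back q o (cs : seq cell) r l : l = [::] \/ l = [:: None] ->
  iter (size cs).+1 step
    (Conf (sweep false q o blank_cell) (behead (rev (syms cs) ++ l))
       (head None (rev (syms cs) ++ l) :: r)) =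
  Conf (inl (inr q)) [:: None] (syms (pops o cs) ++ r).
Proof.
move=> hl; rewrite -map_rev iterS -(size_rev cs) sweep_left -map_rev -/(pops o cs).
by case: hl => ->.
Qed.

Lemma pops_keep (cs : seq cell) : pops [ffun => None] cs = cs.
Proof.
rewrite /pops -[RHS]revK; congr rev; elim: (rev cs) blank_cell => //= d ds IH c.
by congr cons; [apply/ffunP => j; rewrite !ffunE | exact: IH].
Qed.

(** Tracks are aligned at the tops of the stacks: cell [m] holds the letter at depth [m] of each
    stack, or [None] past its bottom. *)
Definition track_tape n (s : J -> seq S) : seq cell :=
  mkseq (fun m => [ffun j => onth (s j) m]) n.

Lemma nth_track_tape n s m : (forall j, size (s j) <= n) ->
  nth blank_cell (track_tape n s) m = [ffun j => onth (s j) m].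
Proof.
move=> hs; have [mn|nm] := ltnP m n; first by rewrite nth_mkseq.
rewrite nth_default ?size_mkseq //; apply/ffunP => j; rewrite !ffunE.
by rewrite onth_default // (leq_trans (hs j)).
Qed.

Lemma onth_behead (T : Type) (s : seq T) m : onth (behead s) m = onth s m.+1.
Proof. by case: s; rewrite //= onth0n. Qed.

(** A pushed track takes each letter from the previous cell, a popped track from the next one, where
    the sweep to the right has not changed it. The added cell is blank on popped tracks, so the way
    back may start from [blank_cell]. *)
Lemma track_tape_act n s (o : ops) : (forall j, size (s j) <= n) ->
  rcons (pops o (pairmap (push_cell o) (pushed o) (track_tape n s)))
    (push_cell o (last (pushed o) (track_tape n s)) blank_cell) =
  track_tape n.+1 (fun j => stack_act (o j) (s j)).
Proof.
move=> hs; set cs := track_tape n s.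
have size_cs : size cs = n by rewrite size_mkseq.
have size_out : size (pops o (pairmap (push_cell o) (pushed o) cs)) = n.
  by rewrite size_rev size_pairmap size_rev size_pairmap.
have pushE m : m < n ->
    nth blank_cell (pairmap (push_cell o) (pushed o) cs) m =
    push_cell o (nth blank_cell (pushed o :: cs) m) (nth blank_cell cs m).
  by move=> mn; rewrite (nth_pairmap blank_cell) ?size_cs.
have prevE m j a : m <= n -> o j = Some (Some a) ->
    nth blank_cell (pushed o :: cs) m j = onth (a :: s j) m.
  case: m => [|m] mn oj /=; first by rewrite ffunE oj.
  by rewrite nth_track_tape // ffunE.
apply: (@eq_from_nth _ blank_cell); first by rewrite size_rcons size_out size_mkseq.
move=> m; rewrite size_rcons size_out ltnS => mn.
rewrite nth_rcons size_out nth_mkseq // ltn_neqAle mn andbT.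
have [m_n|m_n] := eqVneq m n; rewrite /=; apply/ffunP => j.
  rewrite m_n !ffunE (last_nth blank_cell) size_cs.
  case oj: (o j) => [[a|]|]; first by rewrite (prevE n j a).
    by rewrite /= onth_behead onth_default // ltnW // ltnS.
  by rewrite /= onth_default.
have {m_n}mn : m < n by rewrite ltn_neqAle m_n.
rewrite nth_rev size_pairmap size_rev size_pairmap size_cs; last by [].
rewrite (nth_pairmap blank_cell) ?size_rev ?size_pairmap ?size_cs; last by lia.
rewrite nth_rev size_pairmap size_cs; last by lia.
have -> : n - (n - m.+1).+1 = m by lia.
rewrite pushE // !ffunE; case oj: (o j) => [[a|]|].
- by rewrite (prevE m j a) // ltnW.
- rewrite onth_behead; case E: (n - m.+1) => [|k].
    rewrite [nth _ _ _]/= ffunE onth_default // (leq_trans (hs j)) //; lia.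
  rewrite [nth _ (_ :: _) _]/= nth_rev size_pairmap size_cs; last by lia.
  have -> : n - k.+1 = m.+1 by lia.
  by rewrite pushE ?ffunE ?oj ?nth_track_tape ?ffunE //; lia.
- by rewrite nth_track_tape // ffunE.
Qed.

Lemma stack_act_size n (s : J -> seq S) (o : ops) :
  (forall j, size (s j) <= n) -> forall j, size (stack_act (o j) (s j)) <= n.+1.
Proof.
move=> hs j; have := hs j; case: (o j) => [[a|]|] /=; rewrite ?size_behead; lia.
Qed.

Lemma sweeps q o l n s : (forall j, size (s j) <= n) -> l = [::] \/ l = [:: None] ->
  iter (n + (1 + n.+1)) step
    (Conf (sweep true q o (pushed o)) l (syms (track_tape n s))) =
  Conf (inl (inr q)) [:: None]
    (syms (track_tape n.+1 (fun j => stack_act (o j) (s j)))).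
Proof.
move=> hs hl; rewrite -track_tape_act // map_rcons -cats1.
have := sweep_right q o (pushed o) l (track_tape n s).
rewrite size_mkseq => right; rewrite addnC iterD right addnC iterD /=.
set cs := pairmap _ _ _; have <- : size cs = n by rewrite size_pairmap size_mkseq.
exact: sweep_back.
Qed.

(** One step reads the tops in the first cell, which exists by [0 < n]; the two sweeps take
    [2 * n + 2] steps. *)
Lemma track_step n q s : sm_answer q = None -> 0 < n ->
    (forall j, size (s j) <= n) ->
  iter (2 * n + 3) step (Conf (inl (inr q)) [:: None] (syms (track_tape n s))) =
  let: (q', s') := stack_step (q, s) in
  Conf (inl (inr q')) [:: None] (syms (track_tape n.+1 s')).
Proof.
move=> qN n0 hs; have -> : 2 * n + 3 = (n + (1 + n.+1)).+1 by lia.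
rewrite iterSr /= qN; case: n n0 hs => // n _ hs.
rewrite [head _ _]/=.
have -> : ([ffun j => onth (s j) 0] : cell) = (fun j => ohead (s j)) :> (J -> option S).
  by apply/funext => j; rewrite ffunE; case: (s j).
case: (sm_trans q _) => q' o; set o' : ops := [ffun j => o j].
have := sweeps q' o' hs (or_intror erefl).
have -> : (fun j => stack_act (o' j) (s j)) = (fun j => stack_act (o j) (s j)).
  by apply/funext => j; rewrite ffunE.
exact.
Qed.

Definition stack_init (w : seq I) : sm_state P * (J -> seq S) :=
  (sm_start P, fun j => if j == j0 then map load w else [::]).

Lemma track_load w : exists2 t, t = 2 * size w + 2 &
  iter t step (tm_init track_machine w) =
  Conf (inl (inr (sm_start P))) [:: None]
    (syms (track_tape (size w).+1 (stack_init w).2)).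
Proof.
(* Loading, the added blank cell, and the way back. *)
exists (size w + (1 + (size w).+1)); first by lia.
have right l r : iter (size w) step (Conf (inl (inl tt)) l
      ([seq Some (inl i) | i <- w] ++ r)) =
    Conf (inl (inl tt)) (rev (syms (map load_cell w)) ++ l) r.
  by elim: w l => //= i w IH l; rewrite -iterS iterSr /= IH rev_cons cat_rcons.
rewrite addnC iterD /tm_init -[map _ w]cats0 right addnC iterD [iter 1 _ _]/=.
rewrite -(size_map load_cell) sweep_back; last by left.
congr Conf; rewrite cats1 -map_rcons; congr map.
apply: (@eq_from_nth _ blank_cell).
  by rewrite size_rcons pops_keep !size_mkseq size_map.
move=> m; rewrite size_rcons pops_keep size_map => mw.
rewrite nth_rcons size_map nth_mkseq //; apply/ffunP => j; rewrite !ffunE /=.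
move: mw; rewrite ltnS leq_eqVlt => /orP[/eqP ->|mw]; rewrite ?ltnn ?eqxx ?mw.
  by rewrite ffunE; case: eqP => _; rewrite ?onth0n ?onth_default ?size_map.
have [i wi] : exists i, onth w m = Some i.
  by have := onthTE w m; rewrite mw; case: onth => // i; exists i.
rewrite -(odflt_onth blank_cell) !onth_map wi /= ffunE.
by case: eqP => _; rewrite ?onth0n ?onth_map ?wi.
Qed.

(** A simulated step costs [2 * n + 3] on a tape of [n] cells, and [n] grows by at most 1 each time.
    Once the stack machine has answered, both machines stand still. *)
Lemma track_simulation w T :
  exists t n, [/\ t <= 2 * size w + 2 + T * (2 * (size w + T) + 5),
    0 < n <= (size w).+1 + T,
    forall j, size ((iter T (@stack_step S P) (stack_init w)).2 j) <= n &
    iter t step (tm_init track_machine w) =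
    let: (q, s) := iter T (@stack_step S P) (stack_init w) in
    Conf (inl (inr q)) [:: None] (syms (track_tape n s))].
Proof.
elim: T => [|T [t [n [tT n0 hs]]]].
  have [t tE tw] := track_load w; exists t, (size w).+1; split=> //; try lia.
  by move=> j /=; case: ifP => _; rewrite ?size_map.
rewrite iterS; case: (iter T _ _) hs => q s /= hs tE.
case qN: (sm_answer q) => [b|].
  by exists t, n; split=> //; lia.
exists (2 * n + 3 + t), n.+1; split; try nia.
  case: (sm_trans q _) => q' o j /=.
  by have := stack_act_size [ffun j => o j] hs j; rewrite ffunE.
rewrite iterD tE track_step //; last by lia.
by rewrite /stack_step qN.
Qed.

Theorem track_machine_halts w T b :
  sm_answer (iter T (@stack_step S P) (stack_init w)).1 = Some b ->
  exists2 t, t <= 2 * size w + 2 + T * (2 * (size w + T) + 5) &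
    tm_halts_with track_machine w t b.
Proof.
move=> ans; have [t [n [tT _ _ tE]]] := track_simulation w T.
by exists t => //; rewrite /tm_halts_with tE; case: (iter T _ _) ans.
Qed.

End Tracks.

(** * A stack machine for the word problem *)

Inductive letter := LZero | LVar | LStar | LRpar | LMark | LOne.

Inductive stack := TIn | TRead | TVal | TAcc | TRest | TX | TTmp | TY.

Inductive state :=
  | Grid | GridUp | GridDown | Rewind | Read | Var | VarBack
  | Neg | NegFill | NegBack | Plus | PlusAdd | PlusBack
  | Cmp | CmpSub | NextX | Accept | Reject.

Definition letters := [:: LZero; LVar; LStar; LRpar; LMark; LOne].
Definition stacks := [:: TIn; TRead; TVal; TAcc; TRest; TX; TTmp; TY].
Definition states :=
  [:: Grid; GridUp; GridDown; Rewind; Read; Var; VarBack; Neg; NegFill; NegBack;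
      Plus; PlusAdd; PlusBack; Cmp; CmpSub; NextX; Accept; Reject].

Definition letter_index a :=
  match a with
  | LZero => 0 | LVar => 1 | LStar => 2 | LRpar => 3 | LMark => 4 | LOne => 5
  end.
Definition stack_index j :=
  match j with
  | TIn => 0 | TRead => 1 | TVal => 2 | TAcc => 3 | TRest => 4 | TX => 5
  | TTmp => 6 | TY => 7
  end.
Definition state_index q :=
  match q with
  | Grid => 0 | GridUp => 1 | GridDown => 2 | Rewind => 3 | Read => 4 | Var => 5
  | VarBack => 6 | Neg => 7 | NegFill => 8 | NegBack => 9 | Plus => 10
  | PlusAdd => 11 | PlusBack => 12 | Cmp => 13 | CmpSub => 14 | NextX => 15
  | Accept => 16 | Reject => 17
  end.

Lemma letter_indexK : pcancel letter_index (onth letters). Proof. by case. Qed.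
Lemma stack_indexK : pcancel stack_index (onth stacks). Proof. by case. Qed.
Lemma state_indexK : pcancel state_index (onth states). Proof. by case. Qed.

HB.instance Definition _ := Countable.copy letter (pcan_type letter_indexK).
HB.instance Definition _ := Countable.copy stack (pcan_type stack_indexK).
HB.instance Definition _ := Countable.copy state (pcan_type state_indexK).

Lemma letters_enum : Finite.axiom letters. Proof. by case. Qed.
Lemma stacks_enum : Finite.axiom stacks. Proof. by case. Qed.
Lemma states_enum : Finite.axiom states. Proof. by case. Qed.

HB.instance Definition _ := isFinite.Build letter letters_enum.
HB.instance Definition _ := isFinite.Build stack stacks_enum.
HB.instance Definition _ := isFinite.Build state states_enum.

Definition table T (i r v a n x t y : T) (j : stack) : T :=
  match j with
  | TIn => i | TRead => r | TVal => v | TAcc => a | TRest => n | TX => x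
  | TTmp => t | TY => y
  end.

Local Notation "'___'" := (@None (option letter)).
Local Notation pop := (Some (@None letter)).
Local Notation push a := (Some (Some a)).
Local Notation one := (Some (Some LOne)).
Local Notation mark := (Some (Some LMark)).

(* The stack of values [TVal] holds unary numbers, each on top of a mark. The
   accumulator is a unary counter ranging from 0 to the number [d] of grid steps:
   its value is the size of [TAcc], and [TRest] holds the remaining units; between
   two letters of the input it is 0. Likewise the current grid point is the size
   of [TX], and [TY] holds the remaining units. The states [Grid], [GridUp] and
   [GridDown] set [d] to 1 + 2 + ... + N, where N is the length of the input. *)
Definition program (q : state) (top : stack -> option letter) :
    state * (stack -> stack_op letter) :=
  match q with
  (*                          TIn  TRead    TVal TAcc TRest TX  TTmp TY *)
  | Grid => if top TIn is Some a then
      (GridUp,          table pop (push a)  ___  ___  ___  ___  ___  ___)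
    else (Rewind,       table ___  ___      ___  ___  ___  ___  ___  ___)
  | GridUp => if top TRead is Some a then
      (GridUp,          table ___  pop      ___  ___  one  ___ (push a) one)
    else (GridDown,     table ___  ___      ___  ___  ___  ___  ___  ___)
  | GridDown => if top TTmp is Some a then
      (GridDown,        table ___ (push a)  ___  ___  ___  ___  pop  ___)
    else (Grid,         table ___  ___      ___  ___  ___  ___  ___  ___)
  | Rewind => if top TRead is Some a then
      (Rewind,          table (push a) pop  ___  ___  ___  ___  ___  ___)
    else (Read,         table ___  ___      ___  ___  ___  ___  ___  ___)
  | Read => match top TIn with
    | Some LZero =>
      (Read,            table pop (push LZero) mark ___ ___ ___ ___  ___)
    | Some LVar =>
      (Var,             table pop (push LVar) mark ___ ___ ___  ___  ___)
    | Some LStar =>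
      (Neg,             table pop (push LStar) ___ ___ ___ ___  ___  ___)
    | Some LRpar =>
      (Plus,            table pop (push LRpar) ___ ___ ___ ___  ___  ___)
    | Some a =>
      (Read,            table pop (push a)  ___  ___  ___  ___  ___  ___)
    | None =>
      (Cmp,             table ___  ___      ___  ___  ___  ___  ___  ___)
    end
  | Var => if top TX is Some _ then
      (Var,             table ___  ___      one  ___  ___  pop  one  ___)
    else (VarBack,      table ___  ___      ___  ___  ___  ___  ___  ___)
  | VarBack => if top TTmp is Some _ then
      (VarBack,         table ___  ___      ___  ___  ___  one  pop  ___)
    else (Read,         table ___  ___      ___  ___  ___  ___  ___  ___)
  | Neg => if top TVal is Some LOne then
      (Neg,             table ___  ___      pop  one  pop  ___  ___  ___)
    else (NegFill,      table ___  ___      ___  ___  ___  ___  ___  ___)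
  | NegFill => if top TRest is Some _ then
      (NegFill,         table ___  ___      one  one  pop  ___  ___  ___)
    else (NegBack,      table ___  ___      ___  ___  ___  ___  ___  ___)
  | NegBack => if top TAcc is Some _ then
      (NegBack,         table ___  ___      ___  pop  one  ___  ___  ___)
    else (Read,         table ___  ___      ___  ___  ___  ___  ___  ___)
  | Plus => if top TVal is Some LOne then
      (Plus,            table ___  ___      pop  one  pop  ___  ___  ___)
    else (PlusAdd,      table ___  ___      pop  ___  ___  ___  ___  ___)
  | PlusAdd => if top TVal is Some LOne then
      if top TRest is Some _ then
      (PlusAdd,         table ___  ___      pop  one  pop  ___  ___  ___)
      else (PlusAdd,    table ___  ___      pop  ___  ___  ___  ___  ___)
    else (PlusBack,     table ___  ___      ___  ___  ___  ___  ___  ___)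
  | PlusBack => if top TAcc is Some _ then
      (PlusBack,        table ___  ___      one  pop  one  ___  ___  ___)
    else (Read,         table ___  ___      ___  ___  ___  ___  ___  ___)
  | Cmp => if top TVal is Some LOne then
      (Cmp,             table ___  ___      pop  one  pop  ___  ___  ___)
    else (CmpSub,       table ___  ___      pop  ___  ___  ___  ___  ___)
  | CmpSub => match top TVal, top TAcc with
    | Some LOne, Some _ =>
      (CmpSub,          table ___  ___      pop  pop  one  ___  ___  ___)
    | Some LMark, None =>
      (NextX,           table ___  ___      pop  ___  ___  ___  ___  ___)
    | _, _ =>
      (Reject,          table ___  ___      ___  ___  ___  ___  ___  ___)
    end
  | NextX => if top TY is Some _ then
      (Rewind,          table ___  ___      ___  ___  ___  one  ___  pop)
    else (Accept,       table ___  ___      ___  ___  ___  ___  ___  ___)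
  | Accept | Reject =>
      (q,               table ___  ___      ___  ___  ___  ___  ___  ___)
  end.

Definition word_problem_machine : stack_machine letter :=
  @StackMachine letter state stack Grid
    (fun q => match q with
              | Accept => Some true | Reject => Some false | _ => None
              end) program.

Local Notation W := word_problem_machine.
Local Notation conf := (sm_state W * (sm_stack W -> seq letter))%type.
Local Notation step := (@stack_step letter W).
Local Notation ones n := (nseq n LOne).

(** * Runs of the loops of the program *)

Definition reach (t : nat) (c c' : conf) :=
  exists2 k, k <= t & iter k step c = c'.

Lemma reach0 t c : reach t c c.
Proof. by exists 0. Qed.

Lemma reach_trans t1 t2 c1 c2 c3 :
  reach t1 c1 c2 -> reach t2 c2 c3 -> reach (t1 + t2) c1 c3.
Proof.
by move=> [k1 h1 e1] [k2 h2 e2]; exists (k2 + k1); [lia | rewrite iterD e1].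
Qed.

Lemma reachS t c1 c2 c3 : step c1 = c2 -> reach t c2 c3 -> reach t.+1 c1 c3.
Proof. by move=> e [k h e']; exists k.+1 => //; rewrite iterSr e. Qed.

Lemma reach_le t1 t2 c1 c2 : reach t1 c1 c2 -> t1 <= t2 -> reach t2 c1 c2.
Proof. by move=> [k hk e] h; exists k => //; apply: leq_trans h. Qed.

Definition cfg (q : state) i r v a n x t y : conf := (q, table i r v a n x t y).

Lemma stepE q i r v a n x t y : sm_answer (s := W) q = None ->
  step (cfg q i r v a n x t y) =
  let: (q', o) := program q (table (ohead i) (ohead r) (ohead v) (ohead a)
                      (ohead n) (ohead x) (ohead t) (ohead y)) in
  cfg q' (stack_act (o TIn) i) (stack_act (o TRead) r) (stack_act (o TVal) v)
    (stack_act (o TAcc) a) (stack_act (o TRest) n) (stack_act (o TX) x)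
    (stack_act (o TTmp) t) (stack_act (o TY) y).
Proof.
move=> /= ->.
have -> : (fun j => ohead (table i r v a n x t y j)) =
          table (ohead i) (ohead r) (ohead v) (ohead a)
                (ohead n) (ohead x) (ohead t) (ohead y).
  by apply/funext; case.
by case: (program _ _) => q' o; congr pair; apply/funext; case.
Qed.

Ltac go := eapply reachS; [by rewrite stepE | rewrite /=].

Lemma nseq_cat1 (T : Type) (a : T) n s : nseq n a ++ a :: s = a :: nseq n a ++ s.
Proof. by elim: n => //= n ->. Qed.

Lemma reach_grid_up r i v a n x t y :
  reach (size r).+1 (cfg GridUp i r v a n x t y)
    (cfg GridDown i [::] v a (ones (size r) ++ n) x (catrev r t)
       (ones (size r) ++ y)).
Proof.
elim: r n t y => [|b r IH] n t y; first by go; exact: reach0.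
by go; have := IH (LOne :: n) (b :: t) (LOne :: y); rewrite !nseq_cat1.
Qed.

Lemma reach_grid_down t i r v a n x y :
  reach (size t).+1 (cfg GridDown i r v a n x t y)
    (cfg Grid i (catrev t r) v a n x [::] y).
Proof.
elim: t r => [|b t IH] r; first by go; exact: reach0.
by go; exact: IH.
Qed.

(** The grid point is copied by way of [TTmp], from which [VarBack] restores [TX]. *)
Lemma reach_var a b i r v c n y :
  reach a.+1 (cfg Var i r v c n (ones a) (ones b) y)
    (cfg VarBack i r (ones a ++ v) c n [::] (ones (a + b)) y).
Proof.
elim: a b v => [|a IH] b v; first by go; exact: reach0.
by go; have := IH b.+1 (LOne :: v); rewrite nseq_cat1 addnS.
Qed.

Lemma reach_var_back a b i r v c n y :
  reach a.+1 (cfg VarBack i r v c n (ones b) (ones a) y)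
    (cfg Read i r v c n (ones (a + b)) [::] y).
Proof.
elim: a b => [|a IH] b; first by go; exact: reach0.
by go; have := IH b.+1; rewrite addnS.
Qed.

(** With the accumulator at 0, moving a value [e] into it leaves [d - e] units in [TRest]: the
    negation, which [NegFill] writes on the same mark. *)
Lemma reach_neg a b c i r v x t y :
  reach a.+1 (cfg Neg i r (ones a ++ LMark :: v) (ones b) (ones (a + c)) x t y)
    (cfg NegFill i r (LMark :: v) (ones (a + b)) (ones c) x t y).
Proof.
elim: a b => [|a IH] b; first by go; exact: reach0.
by go; have := IH b.+1; rewrite addnS.
Qed.

Lemma reach_neg_fill b c i r v x t y :
  reach c.+1 (cfg NegFill i r v (ones b) (ones c) x t y)
    (cfg NegBack i r (ones c ++ v) (ones (c + b)) [::] x t y).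
Proof.
elim: c b v => [|c IH] b v; first by go; exact: reach0.
by go; have := IH b.+1 (LOne :: v); rewrite nseq_cat1 addnS.
Qed.

Lemma reach_neg_back a b i r v x t y :
  reach a.+1 (cfg NegBack i r v (ones a) (ones b) x t y)
    (cfg Read i r v [::] (ones (a + b)) x t y).
Proof.
elim: a b => [|a IH] b; first by go; exact: reach0.
by go; have := IH b.+1; rewrite addnS.
Qed.

Lemma reach_plus a b c i r v x t y :
  reach a.+1 (cfg Plus i r (ones a ++ LMark :: v) (ones b) (ones (a + c)) x t y)
    (cfg PlusAdd i r v (ones (a + b)) (ones c) x t y).
Proof.
elim: a b => [|a IH] b; first by go; exact: reach0.
by go; have := IH b.+1; rewrite addnS.
Qed.

(** Units met after [TRest] is empty are dropped, which truncates the sum at [d]. *)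
Lemma reach_plus_add a b c i r v x t y :
  reach a.+1 (cfg PlusAdd i r (ones a ++ LMark :: v) (ones b) (ones c) x t y)
    (cfg PlusBack i r (LMark :: v) (ones (minn a c + b)) (ones (c - a)) x t y).
Proof.
elim: a b c => [|a IH] b c; first by go; rewrite min0n subn0; exact: reach0.
by case: c => [|c]; go; [have := IH b 0 | have := IH b.+1 c];
  rewrite ?minnSS ?minn0 ?sub0n ?addnS.
Qed.

Lemma reach_plus_back a b i r v x t y :
  reach a.+1 (cfg PlusBack i r v (ones a) (ones b) x t y)
    (cfg Read i r (ones a ++ v) [::] (ones (a + b)) x t y).
Proof.
elim: a b v => [|a IH] b v; first by go; exact: reach0.
by go; have := IH b.+1 (LOne :: v); rewrite nseq_cat1 addnS.
Qed.

Lemma reach_cmp a b c i r v x t y :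
  reach a.+1 (cfg Cmp i r (ones a ++ LMark :: v) (ones b) (ones (a + c)) x t y)
    (cfg CmpSub i r v (ones (a + b)) (ones c) x t y).
Proof.
elim: a b => [|a IH] b; first by go; exact: reach0.
by go; have := IH b.+1; rewrite addnS.
Qed.

Lemma reach_cmp_sub_eq a c i r v x t y :
  reach a.+1 (cfg CmpSub i r (ones a ++ LMark :: v) (ones a) (ones c) x t y)
    (cfg NextX i r v [::] (ones (a + c)) x t y).
Proof.
elim: a c => [|a IH] c; first by go; exact: reach0.
by go; have := IH c.+1; rewrite addnS.
Qed.

(** Both counters decrease together, and distinct values do not run out simultaneously. *)
Lemma reach_cmp_sub_neq a b c i r v x t y : a <> b ->
  exists s, reach a.+1 (cfg CmpSub i r (ones a ++ LMark :: v) (ones b) (ones c) x t y)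
    (Reject, s).
Proof.
elim: a b c => [|a IH] [|b] c neq_ab //.
- by eexists; go; exact: reach0.
- by eexists; go; exact: reach0.
- have [|s] := IH b c.+1; first by move=> ab; apply: neq_ab; rewrite ab.
  by exists s; go.
Qed.

Lemma reach_rewind r i v a n x t y :
  reach (size r).+1 (cfg Rewind i r v a n x t y)
    (cfg Read (catrev r i) [::] v a n x t y).
Proof.
elim: r i => [|b r IH] i; first by go; exact: reach0.
by go; exact: IH.
Qed.

(** Each letter moved from [TIn] to [TRead] adds the new length of [TRead] to both [TRest] and [TY].
    From an empty [TRead] this sums to a triangular number, so a quadratic [d] is reached without
    multiplication. *)
Lemma reach_grid i r v a m x :
  reach ((size i) * (2 * (size i + size r) + 5)).+1
    (cfg Grid i r v a (ones m) x [::] (ones m))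
    (cfg Rewind [::] (catrev i r) v a
       (ones ('C((size i).+1, 2) + size i * size r + m)) x [::]
       (ones ('C((size i).+1, 2) + size i * size r + m))).
Proof.
elim: i r m => [|b i IH] r m; first by go; exact: reach0.
have -> : 'C((size (b :: i)).+1, 2) + size (b :: i) * size r + m =
  'C((size i).+1, 2) + size i * size (b :: r) + (size (b :: r) + m).
  by rewrite /= binS bin1; lia.
go; eapply reach_le.
  eapply reach_trans; first exact: reach_grid_up.
  eapply reach_trans; first exact: reach_grid_down.
  (* Passing to [TTmp] and back reverses the letters twice. *)
  have -> : catrev (catrev (b :: r) [::]) [::] = b :: r.
    by rewrite !catrevE !cats0 revK.
  rewrite -!nseqD; exact: IH.
by rewrite catrevE cats0 size_rev /=; nia.
Qed.

(* The letters that the evaluation skips are all loaded as [LMark]. *)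
Definition load (s : option symbol) : letter :=
  match s with
  | Some SZero => LZero
  | Some Defs.SX => LVar
  | Some SStar => LStar
  | Some SRpar => LRpar
  | _ => LMark
  end.

Definition input phi := [seq load (Some s) | s <- formula_string phi].

(** A formula adds its value on a new mark, above arbitrary earlier values, and restores the
    accumulator and [TX]. The costliest case is a sum: besides its two parts it takes three letters,
    three loop exits and three unary numbers of size at most [d], hence [3 * d + 6]. *)
Lemma reach_read phi d k i r v y : k <= d ->
  reach (formula_length phi * (3 * d + 6))
    (cfg Read (input phi ++ i) r v [::] (ones d) (ones k) [::] y)
    (cfg Read i (catrev (input phi) r) (ones (chain_eval d k phi) ++ LMark :: v)
       [::] (ones d) (ones k) [::] y).
Proof.
move=> kd; rewrite /formula_length.
elim: phi i r v => [||phi IH|phi IHphi psi IHpsi] i r v /=.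
- by apply: (@reach_le 1); [go; exact: reach0 | lia].
- apply: (@reach_le (k.+1 + k.+1).+1); last by lia.
  go.
  apply: reach_trans (reach_var k 0 _ _ _ _ _ _) _.
  by have := reach_var_back k 0 i (LVar :: r) (ones k ++ LMark :: v) [::] (ones d) y;
    rewrite !addn0.
- rewrite /input /= map_rcons cat_rcons size_rcons mulSn addnC.
  apply: reach_trans (IH _ _ _) _; rewrite -cats1 catrev_catl.
  set e := chain_eval d k phi; have ed : e <= d by apply: chain_eval_le.
  apply: (@reach_le (e.+1 + ((d - e).+1 + d.+1)).+1); last by lia.
  go.
  have h1 := reach_neg e 0 (d - e) i (LStar :: catrev (input phi) r) v (ones k) [::] y.
  rewrite subnKC // in h1; apply: reach_trans h1 _.
  apply: reach_trans (reach_neg_fill _ _ _ _ _ _ _ _) _.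
  have := reach_neg_back d 0 i (LStar :: catrev (input phi) r) (ones (d - e) ++ LMark :: v)
    (ones k) [::] y.
  by rewrite !addn0 subnK.
- rewrite /input /= map_cat /= map_cat /= -!catA /= -catA /=.
  set e := chain_eval d k phi; have ed : e <= d by apply: chain_eval_le.
  set f := chain_eval d k psi; have fd : f <= d by apply: chain_eval_le.
  eapply reach_le.
    go; eapply reach_trans; first exact: IHphi.
    go; eapply reach_trans; first exact: IHpsi.
    have h1 := reach_plus f 0 (d - f) i
      (LRpar :: catrev (input psi) (LMark :: catrev (input phi) (LMark :: r)))
      (ones e ++ LMark :: v) (ones k) [::] y.
    rewrite subnKC // in h1; go; apply: reach_trans h1 _.
    apply: reach_trans (reach_plus_add _ _ _ _ _ _ _ _ _) _.
    have := reach_plus_back (minn e (d - f) + (f + 0)) (d - f - e) i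
      (LRpar :: catrev (input psi) (LMark :: catrev (input phi) (LMark :: r)))
      (LMark :: v) (ones k) [::] y.
    have -> : minn e (d - f) + (f + 0) + (d - f - e) = d by lia.
    have -> : minn e (d - f) + (f + 0) = minn d (e + f) by lia.
    rewrite !catrev_catl /= catrev_catl /=.
    exact.
  rewrite !size_cat /= size_cat /=; lia.
Qed.

Lemma size_input phi : size (input phi) = formula_length phi.
Proof. by rewrite size_map. Qed.

Lemma formula_length_gt0 phi : 0 < formula_length phi.
Proof. by rewrite /formula_length; case: phi => //= phi; rewrite size_rcons. Qed.

(** * Comparing two formulas on the whole grid *)

Section Decide.
Variables (phi psi : formula).

Let n := formula_length phi + formula_length psi.
Let w := input phi ++ LMark :: input psi.

Lemma size_pair_input : size w = n.+1.
Proof. by rewrite size_cat /= !size_input addnS. Qed.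

Lemma pair_inputE : map load (pair_string phi psi) = w.
Proof. by rewrite /pair_string map_cat /= -!map_comp. Qed.

(** The separator is skipped, so the value of [psi] ends up above that of [phi], and [Cmp] moves it
    into the accumulator. *)
Lemma reach_cmp_start d k m : k <= d ->
  reach (n.+1 + n * (3 * d + 6) + d + 5)
    (cfg Rewind [::] (rev w) [::] [::] (ones d) (ones k) [::] m)
    (cfg CmpSub [::] (rev w) (ones (chain_eval d k phi) ++ [:: LMark])
       (ones (chain_eval d k psi)) (ones (d - chain_eval d k psi)) (ones k) [::] m).
Proof.
move=> kd; set f := chain_eval d k psi.
have fd : f <= d by apply: chain_eval_le.
eapply reach_le.
  eapply reach_trans; first exact: reach_rewind.
  rewrite catrevE revK cats0 /w.
  eapply reach_trans; first exact: reach_read.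
  go; eapply reach_trans; first by rewrite -[input psi]cats0; exact: reach_read.
  go; have := reach_cmp f 0 (d - f) [::] (rev w)
    (ones (chain_eval d k phi) ++ [:: LMark]) (ones k) [::] m.
  rewrite addn0 subnKC // /w !catrevE rev_cat rev_cons cats0 cat_rcons; exact.
by rewrite size_rev size_pair_input; nia.
Qed.

Lemma reach_round d k m : k <= d ->
  exists s, reach (n.+1 * (3 * d + 7))
    (cfg Rewind [::] (rev w) [::] [::] (ones d) (ones k) [::] m)
    (if chain_eval d k phi == chain_eval d k psi
     then cfg NextX [::] (rev w) [::] [::] (ones d) (ones k) [::] m
     else (Reject, s)).
Proof.
move=> kd; have start := reach_cmp_start m kd.
have := chain_eval_le phi kd; have := chain_eval_le psi kd.
move: start; set e := chain_eval d k phi; set f := chain_eval d k psi.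
move=> start fd ed; case: eqP => [ef|ef].
  (* A dummy witness: [s] describes the stacks after a rejection. *)
  exists (fun=> [::]); eapply reach_le; first (eapply reach_trans; first exact: start).
    rewrite -ef; have := reach_cmp_sub_eq e (d - e) [::] (rev w) [::] (ones k) [::] m.
    by rewrite subnKC //; exact.
  by nia.
have [s hs] := reach_cmp_sub_neq (d - f) [::] (rev w) [::] (ones k) [::] m ef.
exists s; eapply reach_le; first exact: reach_trans start hs.
by nia.
Qed.

(** [m] counts the grid points still to come after [k]; the first disagreement rejects at once. *)
Lemma reach_decide d m k : k + m = d ->
  exists2 c, reach (m.+1 * (n.+1 * (3 * d + 7)).+1)
      (cfg Rewind [::] (rev w) [::] [::] (ones d) (ones k) [::] (ones m)) c &
    sm_answer c.1 =
    Some (all (fun i => chain_eval d i phi == chain_eval d i psi) (iota k m.+1)).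
Proof.
set R := n.+1 * (3 * d + 7); elim: m k => [|m IH] k kmd.
  have [|s] := @reach_round d k (ones 0); first by lia.
  rewrite /= andbT; case: eqP => _ hs; last first.
    by exists (Reject, s) => //; apply: reach_le hs _; rewrite -/R; lia.
  eexists; first (eapply reach_le; first (eapply reach_trans; first exact: hs)).
  - by go; exact: (reach0 0).
  - by rewrite -/R; lia.
  - by [].
have [|s] := @reach_round d k (ones m.+1); first by lia.
rewrite [iota _ _]/= [all _ _]/=; case: eqP => _ hs; last first.
  by exists (Reject, s) => //; apply: reach_le hs _; rewrite -/R; nia.
have [|c hc ans] := IH k.+1; first by lia.
exists c; last exact: ans.
eapply reach_le; first (eapply reach_trans; first exact: hs).
- by go; exact: hc.
- by rewrite -/R; nia.
Qed.

(** With the separator the input has [n + 1] letters, and [d] is the corresponding triangular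
    number. *)
Lemma reach_answer :
  let d := 'C(n.+2, 2) in
  exists2 c, reach ((n.+1 * (2 * n.+1 + 5)).+1 + d.+1 * (n.+1 * (3 * d + 7)).+1)
      (stack_init (P := W) TIn load (pair_string phi psi)) c &
    sm_answer c.1 =
    Some (all (fun i => chain_eval d i phi == chain_eval d i psi) (iota 0 d.+1)).
Proof.
move=> d; have [c hc ans] := @reach_decide d d 0 erefl.
exists c => //; apply: reach_trans hc.
have -> : stack_init (P := W) TIn load (pair_string phi psi) =
    cfg Grid w [::] [::] [::] (ones 0) [::] [::] (ones 0).
  rewrite /stack_init; congr pair; apply/funext; case; rewrite /= ?pair_inputE //.
have := reach_grid w [::] [::] [::] 0 [::].
by rewrite size_pair_input muln0 !addn0 catrevE cats0.
Qed.

End Decide.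

(** * Polynomial time bounds *)

Lemma leq_add_exp n a b k : 2 <= n -> a <= n ^ k -> b <= n ^ k -> a + b <= n ^ k.+1.
Proof. by move=> n2 ha hb; rewrite expnS; nia. Qed.

Lemma leq_mul_exp n a b k l : a <= n ^ k -> b <= n ^ l -> a * b <= n ^ (k + l).
Proof. by rewrite expnD; exact: leq_mul. Qed.

(** Every factor is bounded by a power of [n], and as [n >= 2] a sum costs one further factor [n].
    The exponent is 4 + (2 + 7 + 1) + 1. *)
Lemma decision_time n : 2 <= n ->
  (n.+1 * (2 * n.+1 + 5)).+1 +
    'C(n.+2, 2).+1 * (n.+1 * (3 * 'C(n.+2, 2) + 7)).+1 <= n ^ 15.
Proof.
move=> n2; have : 'C(n.+2, 2) * 2 = n.+2 * n.+1.
  by rewrite bin2 -divn2 divnK // dvdn2 oddM /=; case: odd.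
move: 'C(n.+2, 2) => d hd.
have exp2 k : n ^ k.+2 = n * n * n ^ k by rewrite !expnS mulnA.
have n_1 : n.+1 <= n ^ 2 by rewrite exp2 expn0; nia.
have n_2 : 2 * n.+1 + 5 <= n ^ 4 by rewrite !exp2 expn0; nia.
have d_1 : d.+1 <= n ^ 4 by rewrite !exp2 expn0; nia.
have d_7 : 3 * d + 7 <= n ^ 7.
  have : 3 * d + 7 <= 8 * n ^ 4 by lia.
  move/leq_trans; apply; rewrite -[7]/(3 + 4) expnD leq_mul2r.
  by apply/orP; right; rewrite -[8]/(2 ^ 3) leq_exp2r.
have le_exp k l : k <= l -> n ^ k <= n ^ l by move=> kl; rewrite leq_pexp2l //; lia.
have small k : 1 <= n ^ k by rewrite expn_gt0; lia.
apply: (leq_add_exp (k := 14)) => //.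
  rewrite -addn1; apply: (leq_trans _ (le_exp 7 14 isT)).
  by apply: leq_add_exp => //; exact: (leq_mul_exp n_1 n_2).
apply: (leq_mul_exp (k := 4) (l := 10)) => //.
rewrite -addn1.
by apply: leq_add_exp => //; exact: (leq_mul_exp n_1 d_7).
Qed.

(** The simulation squares the time: with [B = n ^ 15] the total is below [4 * B ^ 2], and [n ^ 2]
    absorbs the 4, whence the exponent 2 * 15 + 2. *)
Lemma machine_time n k : 2 <= n -> k <= n ^ 15 ->
  2 * n.+1 + 2 + k * (2 * (n.+1 + k) + 5) < n ^ 32.
Proof.
move=> n2 kB; have -> : n ^ 32 = n * n * (n ^ 15 * n ^ 15).
  by rewrite -expnD -mulnA -!expnS.
have : 2 * n + 8 <= n ^ 15.
  apply: (@leq_trans (n ^ 1 * n ^ 14)); last by rewrite -expnD.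
  rewrite expn1; apply: (@leq_trans (n * 6)); first by nia.
  rewrite leq_mul2l; apply/orP; right; apply: (@leq_trans (2 ^ 3)) => //.
  by apply: (@leq_trans (n ^ 3)); [rewrite leq_exp2r | rewrite leq_pexp2l //; lia].
move: (n ^ 15) kB => B kB hB.
have : k * (2 * (n.+1 + k) + 5) <= B * (3 * B) by apply: leq_mul; lia.
have : 4 * (B * B) <= n * n * (B * B) by apply: leq_mul; nia.
nia.
Qed.

Lemma chain_evals_eqP (R : realType) phi psi :
  let d := 'C((formula_length phi + formula_length psi).+2, 2) in
  all (fun i => chain_eval d i phi == chain_eval d i psi) (iota 0 d.+1) <->
  formula_fun R phi = formula_fun R psi.
Proof.
(* For the total length [n], this [K] bounds the occurrences of X in either formula, and
   [4 * K ^ 2 <= (n + 1) ^ 2 <= 2 * d]. *)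
move=> d; pose K := (formula_length phi + formula_length psi).+1./2.
have := formula_vars_length phi; have := formula_vars_length psi.
have := formula_length_gt0 phi; have := formula_length_gt0 psi => h1 h2 h3 h4.
have dK : 2 * (K * K) <= d.
  have : d * 2 = (formula_length phi + formula_length psi).+2 *
                 (formula_length phi + formula_length psi).+1.
    by rewrite /d bin2 -divn2 divnK // dvdn2 oddM /=; case: odd.
  have : K * 2 <= (formula_length phi + formula_length psi).+1 by rewrite /K; lia.
  by nia.
rewrite (@formula_fun_chainP R K d); try lia.
split=> [/allP h i id|h]; first by apply/eqP/h; rewrite mem_iota.
by apply/allP => i; rewrite mem_iota => id; apply/eqP/h.
Qed.

Theorem theorem5p2 (R : realType) (M1 : cstarAlgType R) (hM1 : is_farey_AF M1)
    (E : elliott_monoid M1) (p : projection M1)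
    (hp : generates E (mvn_class p))
    (omega : mcnaughton R -> mvn_classes M1)
    (homega : is_elliott_iso E omega)
    (homega_id : omega mc_id = mvn_class p) :
  exists (T : {poly nat}) (M : turing_machine (option symbol)),
    forall phi psi : formula,
      exists t : nat, exists b : bool,
        [/\ (t < T.[(formula_length phi + formula_length psi)%N]%R)%N,
            tm_halts_with M (pair_string phi psi) t b
          & b <-> omega (formula_fun R phi) = omega (formula_fun R psi)].
Proof.
exists ('X^32)%R, (track_machine (P := word_problem_machine) TIn load) => phi psi.
have [c [k hk run] ans] := reach_answer phi psi.
rewrite -run in ans; have [t ht halts] := track_machine_halts ans.
exists t; eexists; split; [|exact: halts|].
  have n2 : 2 <= formula_length phi + formula_length psi.
    by have := formula_length_gt0 phi; have := formula_length_gt0 psi; lia.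
  rewrite hornerXn natrXE; apply: leq_ltn_trans ht _.
  have -> : size (pair_string phi psi) = (formula_length phi + formula_length psi).+1.
    by rewrite -(size_map load) pair_inputE size_pair_input.
  exact: machine_time n2 (leq_trans hk (decision_time n2)).
rewrite chain_evals_eqP; split=> [-> //|].
exact: (bij_inj (elliott_iso_bij homega)).
Qed.
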